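(* Let $G$ be a completely metrizable topological group with identity $e$, let $d$ be a left-invariant compatible metric on $G$, and let $T\colon G\to G$ be a continuous endomorphism of $G$. Then the following assertions are equivalent: (1) $T$ admits a dense set of mean semi-irregular points; (2) $T$ admits a residual set of mean semi-irregular points; (3) there exists $\delta>0$ such that for every sequence $(O_j)_{j\in\mathbb{N}}$ of nonempty open subsets of $G$, there exists a sequence $(K_j)_{j\in\mathbb{N}}$ of Cantor sets with $K_j\subset O_j$ such that $\bigcup_{j=1}^\infty K_j$ is mean Li-Yorke $\delta$-scrambled; (4) the mean proximal relation of $T$ is dense in $G\times G$ and $T$ is mean sensitive; (5) the mean proximal cell of $e$ is dense in $G$ and there exists $x\in G$ such that $\limsup_{n\to\infty} \frac{1}{n}\sum_{i=1}^{n} d(T^ix,e)>0$.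
   Context: A topological group is completely metrizable if its topology is induced by some complete metric. A compatible metric $d$ on $G$ is a metric inducing the topology of $G$ (not required to be complete); it is left-invariant if $d(zx,zy)=d(x,y)$ for all $x,y,z\in G$. A continuous endomorphism is a continuous group homomorphism $G\to G$. $\mathbb{N}$ is the set of positive integers. A set is residual if it contains a dense $G_\delta$ subset. A Cantor set is a subset homeomorphic to the Cantor ternary set. A point $x\in G$ is mean semi-irregular for $T$ if $\liminf_{n\to\infty}\frac1n\sum_{i=1}^n d(T^ix,e)=0$ and $\limsup_{n\to\infty}\frac1n\sum_{i=1}^n d(T^ix,e)>0$. A pair $(x,y)\in G\times G$ is mean proximal if $\liminf_{n\to\infty}\frac1n\sum_{i=1}^n d(T^ix,T^iy)=0$; the mean proximal relation is the set of mean proximal pairs; the mean proximal cell of $x$ is $\{y\in G:(x,y)\text{ is mean proximal}\}$. For $\delta>0$, a pair $(x,y)$ is mean Li-Yorke $\delta$-chaotic if it is mean proximal and $\limsup_{n\to\infty}\frac1n\sum_{i=1}^n d(T^ix,T^iy)\ge\delta$. A set $K\subset G$ is mean Li-Yorke $\delta$-scrambled if any two distinct points of $K$ form a mean Li-Yorke $\delta$-chaotic pair. $T$ is mean sensitive if there exists $\delta>0$ such that, for every $x\in G$ and $\varepsilon>0$, there exists $y\in G$ with $d(x,y)<\varepsilon$ and $\limsup_{n\to\infty}\frac1n\sum_{i=1}^n d(T^ix,T^iy)\ge\delta$. *)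

(* Defs.v *)
From HB Require Import structures.
From mathcomp Require Import all_boot all_order all_algebra monoid.
From mathcomp Require Import all_classical all_reals all_analysis borel_hierarchy.

Set Implicit Arguments.
Unset Strict Implicit.
Unset Printing Implicit Defensive.

Import Order.TTheory GRing.Theory Num.Theory.
Import numFieldNormedType.Exports.

Local Open Scope classical_set_scope.
Local Open Scope ring_scope.

(* The library only has additive (hence abelian) topological groups. *)
HB.mixin Record isTopologicalGroup G & Topological G & Group G := {
  mulg_continuous : continuous (fun p : G * G => (p.1 * p.2)%g) ;
  invg_continuous : continuous (fun x : G => (x^-1)%g)
}.

#[short(type="topologicalGroupType")]
HB.structure Definition TopologicalGroup :=
  {G of Topological G & Group G & isTopologicalGroup G}.

Section metrics.
Context {R : realType}.

(* A [metricType] carries a single distance, whereas here several metrics live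
   on one given topological space; so metrics are plain functions. *)
Definition is_metric (X : Type) (d : X -> X -> R) :=
  [/\ forall x y, 0 <= d x y,
      forall x y, d x y = 0 <-> x = y,
      forall x y, d x y = d y x &
      forall x y z, d x z <= d x y + d y z].

Definition compatible_metric (X : topologicalType) (d : X -> X -> R) :=
  is_metric d /\
  forall x : X, nbhs x = nbhs_ball_ (fun y (r : R) => [set z | d y z < r]) x.

(* Only used with [d] a compatible metric, so convergence in the topology of
   [X] is convergence for [d]. *)
Definition complete_metric (X : topologicalType) (d : X -> X -> R) :=
  forall u : nat -> X,
    (forall eps : R, 0 < eps -> exists N : nat, forall m n : nat,
       (N <= m)%N -> (N <= n)%N -> d (u m) (u n) < eps) ->
    exists l : X, u @ \oo --> l.

Definition left_invariant (G : groupType) (d : G -> G -> R) :=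
  forall x y z : G, d (z * x)%g (z * y)%g = d x y.

End metrics.

Definition completely_metrizable (R : realType) (X : topologicalType) :=
  exists rho : X -> X -> R, compatible_metric rho /\ complete_metric rho.

Definition residual (X : topologicalType) (S : set X) :=
  exists D : set X, [/\ Gdelta D, dense D & D `<=` S].

Definition homeomorphic_sets (X Y : topologicalType) (A : set X) (B : set Y) :=
  exists (f : X -> Y) (g : Y -> X),
    [/\ {within A, continuous f} /\ {within B, continuous g},
        {homo f : x / A x >-> B x} /\ {homo g : y / B y >-> A y},
        {in A, cancel f g} & {in B, cancel g f}].

(* From one stage to the next, the open middle third of each interval is
   removed: C_(n+1) = C_n / 3 `|` (2 + C_n) / 3. *)
Fixpoint cantor_stage {R : realType} (n : nat) : set R :=
  if n is m.+1 then
    [set x | cantor_stage m (3 * x) \/ cantor_stage m (3 * x - 2)]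
  else [set x | 0 <= x <= 1].

Definition cantor_ternary {R : realType} : set R :=
  \bigcap_n cantor_stage n.

Definition cantor_subset (R : realType) (X : topologicalType) (K : set X) :=
  homeomorphic_sets (@cantor_ternary R) K.

Section mean_dynamics.
Context {R : realType}.

(* The value at [n = 0] is [0], which affects neither the limsup nor the liminf.
   These are taken in [\bar R], since [d] may be unbounded. *)
Definition averages (u : nat -> R) (n : nat) : \bar R :=
  (n%:R^-1 * \sum_(1 <= i < n.+1) u i)%:E.

Definition mean_limsup (u : nat -> R) : \bar R := limn_esup (averages u).

Definition mean_liminf (u : nat -> R) : \bar R := limn_einf (averages u).

Definition orbit_dist (X : Type) (d : X -> X -> R) (T : X -> X) (x y : X)
  (i : nat) : R := d (iter i T x) (iter i T y).

Definition mean_semi_irregular (G : groupType) (d : G -> G -> R) (T : G -> G)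
    (x : G) :=
  mean_liminf (fun i => d (iter i T x) 1%g) = 0%E /\
  (0 < mean_limsup (fun i => d (iter i T x) 1%g))%E.

Definition mean_proximal (X : Type) (d : X -> X -> R) (T : X -> X) (x y : X) :=
  mean_liminf (orbit_dist d T x y) = 0%E.

Definition mean_proximal_relation (X : Type) (d : X -> X -> R) (T : X -> X) :
  set (X * X) := [set p | mean_proximal d T p.1 p.2].

Definition mean_proximal_cell (X : Type) (d : X -> X -> R) (T : X -> X)
  (x : X) : set X := [set y | mean_proximal d T x y].

Definition mean_li_yorke_chaotic (X : Type) (d : X -> X -> R) (T : X -> X)
    (delta : R) (x y : X) :=
  mean_proximal d T x y /\ (delta%:E <= mean_limsup (orbit_dist d T x y))%E.

Definition mean_li_yorke_scrambled (X : Type) (d : X -> X -> R) (T : X -> X)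
    (delta : R) (K : set X) :=
  forall x y : X, K x -> K y -> x <> y -> mean_li_yorke_chaotic d T delta x y.

Definition mean_sensitive (X : Type) (d : X -> X -> R) (T : X -> X) :=
  exists2 delta : R, 0 < delta &
    forall (x : X) (eps : R), 0 < eps ->
      exists y : X, d x y < eps /\
        (delta%:E <= mean_limsup (orbit_dist d T x y))%E.

End mean_dynamics.

(* Main.v *)
Require Import Defs.
From HB Require Import structures.
From mathcomp Require Import all_boot all_order all_algebra monoid.
From mathcomp Require Import all_classical all_reals all_analysis.
From mathcomp Require Import lra.

Set Implicit Arguments.
Unset Strict Implicit.
Unset Printing Implicit Defensive.

Import Order.TTheory GRing.Theory Num.Theory.
Import numFieldNormedType.Exports.

Local Open Scope classical_set_scope.
Local Open Scope ring_scope.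

(** Write A_n(x, y) for the average of d(T^i x, T^i y) over 1 <= i <= n. Since
    T is an endomorphism and d is left-invariant, A_n is a left-invariant
    pseudometric, so everything about a pair (x, y) can be read off the single
    point x^-1 y, and conversely.

    The heart of the matter is that a dense proximal cell of 1, together with a
    single point x0 whose averages do not tend to 0, yields one delta > 0 that
    works everywhere. Say that the averages A_n(1, x0) exceed c infinitely
    often. If the points of some ball around 1 had averages eventually at most
    c / 4, a point z of the dense proximal cell of 1, chosen near x0, would
    inherit large averages from x0. But averages of z get arbitrarily small along a
    subsequence, so some T^i z lies in the ball; and dropping the first i terms
    of the orbit does not change the upper limit of averages, a contradiction
    ([spread_near1]). Hence points with large averages accumulate at 1, and by
    translation they are dense: either x itself has large averages, or x y does
    for a suitable y near 1 ([dense_spread]).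

    Consequently the conditions `some A_m(1, x) with m >= n is smaller than
    1 / (n + 1), and some A_m(1, x) with m >= n exceeds delta' define dense open
    sets of x ([dense_chaotic_stage1]). Their intersection consists of mean
    semi-irregular points and is residual by Baire's theorem. By left
    translation the same conditions on A_m(x, y) define dense open subsets of
    G x G ([dense_chaotic_stage]), decreasing in n and disjoint from the diagonal. A
    Mycielski construction ([mycielski]) then plants, in countably many
    prescribed open sets, Cantor sets whose union has all its off-diagonal pairs
    in these sets, and is therefore scrambled: the open sets are refined along
    countably many binary trees, and each level imposes finitely many
    conditions.

    The remaining implications are short: Cantor sets in prescribed open sets
    give proximal pairs everywhere and, by the triangle inequality, mean
    sensitivity with constant delta / 4; a proximal pair (x, y) with x near 1
    and y near w gives the point x^-1 y of the proximal cell of 1 near w. *)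

(** * Upper and lower limits of averages *)

Definition frequently (P : nat -> Prop) :=
  forall N, exists2 n, (N <= n)%N & P n.

Lemma frequently_sub (P Q : nat -> Prop) :
  (forall n, P n -> Q n) -> frequently P -> frequently Q.
Proof. by move=> PQ fP N; have [n Nn /PQ] := fP N; exists n. Qed.

Lemma not_frequently (P : nat -> Prop) :
  ~ frequently P -> exists N, forall n, (N <= n)%N -> ~ P n.
Proof.
move=> /existsNP[N nP]; exists N => n Nn Pn.
by apply: nP; exists n.
Qed.

Lemma frequently_or (P Q : nat -> Prop) :
  frequently (fun n => P n \/ Q n) -> frequently P \/ frequently Q.
Proof.
move=> PQ; have [fP|/not_frequently[N nP]] := pselect (frequently P).
  by left.
right => M; have [n] := PQ (maxn N M).
rewrite geq_max => /andP[Nn Mn] [/(nP _ Nn)//|Qn].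
by exists n.
Qed.

Section mean_limits.
Context {R : realType}.
Implicit Types (u a : nat -> R) (c : R).

Lemma frequently_limn_esup a c :
  (c%:E < limn_esup (EFin \o a))%E -> frequently (fun n => c < a n).
Proof.
move=> ca N.
have : (c%:E < ereal_sup ((EFin \o a) @` [set n | (N <= n)%N]))%E.
  apply: (lt_le_trans ca); apply: ereal_inf_lbound => /=.
  by exists [set n | (N <= n)%N] => //; exists N.
by move=> /ereal_sup_gt[_ [n Nn <-]]; rewrite lte_fin; exists n.
Qed.

Lemma limn_esup_frequently a c :
  frequently (fun n => c < a n) -> (c%:E <= limn_esup (EFin \o a))%E.
Proof.
move=> ca; apply: le_ereal_inf_tmp => _ [A [N _ NA] <-].
have [n Nn can] := ca N.
apply: (@le_trans _ _ (a n)%:E); first by rewrite lee_fin ltW.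
by apply: ereal_sup_ubound; exists n => //; exact: NA.
Qed.

Definition avg u n : R := n%:R^-1 * \sum_(1 <= i < n.+1) u i.

(** Upper limits are compared with constants only, through statements of the
    form `infinitely many averages exceed c'; this avoids arithmetic in the
    extended reals, where the upper limit may be infinite. *)
Lemma mean_limsup_gt u c :
  (c%:E < mean_limsup u)%E -> frequently (fun n => c < avg u n).
Proof. exact: frequently_limn_esup. Qed.

Lemma mean_limsup_ge u c :
  frequently (fun n => c < avg u n) -> (c%:E <= mean_limsup u)%E.
Proof. exact: limn_esup_frequently. Qed.

Lemma mean_limsup_gt0 u : (0 < mean_limsup u)%E ->
  exists2 c : R, 0 < c & frequently (fun n => c < avg u n).
Proof.
have [[r| |]] : exists r : \bar R, r = mean_limsup u by exists (mean_limsup u).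
- move=> Er u0; exists (r / 2); first by move: u0; rewrite -Er lte_fin; lra.
  by apply: mean_limsup_gt; move: u0; rewrite -Er !lte_fin; lra.
- by move=> E _; exists 1 => //; apply: mean_limsup_gt; rewrite -E ltry.
- by move=> <-.
Qed.

Lemma avg_ge0 u n : (forall i, 0 <= u i) -> 0 <= avg u n.
Proof. by move=> u0; rewrite mulr_ge0 ?invr_ge0// sumr_ge0. Qed.

Lemma mean_liminf_eq0 u : (forall i, 0 <= u i) ->
  mean_liminf u = 0%E <-> forall e : R, 0 < e ->
    frequently (fun n => avg u n < e).
Proof.
move=> u0.
have -> : mean_liminf u =
    (- limn_esup (EFin \o (fun n => (- avg u n)%R)))%E by [].
split=> [/eqP|ue].
  rewrite eqe_oppLR oppe0 => /eqP E e e0.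
  have : frequently (fun n => - e < - avg u n).
    by apply: frequently_limn_esup; rewrite E lte_fin oppr_lt0.
  by apply: frequently_sub => n; rewrite ltrN2.
apply/eqP; rewrite eqe_oppLR oppe0 eq_le; apply/andP; split.
  apply: (@le_trans _ _ (ereal_sup ((EFin \o (fun n => - avg u n)) @` setT))).
    by apply: ereal_inf_lbound; exists setT => //; exact: filterT.
  by apply: ge_ereal_sup => _ [n _ <-]; rewrite lee_fin oppr_le0 avg_ge0.
apply/lee_addgt0Pr => e e0; rewrite -leeBlDr//.
rewrite sub0e; apply: limn_esup_frequently.
by apply: frequently_sub (ue e e0) => n; rewrite ltrN2.
Qed.

End mean_limits.

(** * Metrics compatible with a topology *)

Section compatible_metric.
Context {R : realType} (X : topologicalType) (d : X -> X -> R).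
Hypothesis hd : compatible_metric d.

Lemma metric_ge0 x y : 0 <= d x y.
Proof. by case: hd => -[]. Qed.

Lemma metric_xx x : d x x = 0.
Proof. by case: hd => -[_ /(_ x x)[_ ->]]. Qed.

Lemma metric_sym x y : d x y = d y x.
Proof. by case: hd => -[]. Qed.

Lemma metric_triangle y x z : d x z <= d x y + d y z.
Proof. by case: hd => -[]. Qed.

Lemma nbhs_metricP x (A : set X) :
  nbhs x A <-> exists2 r : R, 0 < r & forall y, d x y < r -> A y.
Proof.
case: hd => _ ->; split=> -[r r0 rA]; exists r => //.
Qed.

Lemma open_metric_ball x (r : R) : open [set y | d x y < r].
Proof.
rewrite openE => y /= xyr; apply/nbhs_metricP.
exists (r - d x y); first by rewrite subr_gt0.
by move=> z yz /=; apply: le_lt_trans (metric_triangle y _ _) _; lra.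
Qed.

Lemma continuous_metric : continuous (fun p : X * X => d p.1 p.2).
Proof.
move=> [x y]; apply/cvgrPdist_lt => e e0 /=.
exists ([set x' | d x x' < e / 2], [set y' | d y y' < e / 2]) => /=.
  by split; apply/nbhs_metricP; exists (e / 2) => //; rewrite divr_gt0.
move=> [x' y'] /= [xx' yy'].
have := metric_triangle x x' y'; have := metric_triangle y x y'.
have := metric_triangle x' x y; have := metric_triangle y' x' y.
rewrite (metric_sym x' x) (metric_sym y' y) => ? ? ? ?.
by rewrite ltr_norml; lra.
Qed.

End compatible_metric.
(** * Nested sets in a complete metric space *)

Section complete_metric.
Context {R : realType} (X : topologicalType) (rho : X -> X -> R).
Hypotheses (hrho : compatible_metric rho) (rhoC : complete_metric rho).

Lemma shrink_open (A : set X) (e : R) : open A -> A !=set0 -> 0 < e ->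
  exists B : set X, [/\ open B, B !=set0, closure B `<=` A &
    forall x y, B x -> B y -> rho x y < e].
Proof.
move=> oA [a Aa] e0.
have /(nbhs_metricP hrho)[r r0 rA] : nbhs a A by exact: open_nbhs_nbhs.
pose s := Num.min (r / 2) (e / 2).
have s0 : 0 < s by rewrite lt_min !divr_gt0.
have [sr se] : s <= r / 2 /\ s <= e / 2.
  by rewrite /s; split; rewrite ge_min lexx ?orbT.
exists [set y | rho a y < s]; split.
- exact: open_metric_ball.
- by exists a => /=; rewrite metric_xx.
- move=> x clx; apply: rA.
  have [y [/= ay xy]] := clx _ (open_nbhs_nbhs
    (conj (open_metric_ball hrho x s)
          (eq_ind_r (fun t => t < s) s0 (metric_xx hrho x)))).
  have := metric_triangle hrho y a x.
  by rewrite (metric_sym hrho y x); lra.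
- move=> x y /= ax ay; have := metric_triangle hrho a x y.
  by rewrite (metric_sym hrho x a); lra.
Qed.

(** Cantor's intersection theorem. The diameter of the initial set is left free,
    so that it can be an arbitrary prescribed open set. *)
Lemma nested_point (F : nat -> set X) :
  (forall n, F n !=set0) ->
  (forall n, closure (F n.+1) `<=` F n) ->
  (forall n x y, F n.+1 x -> F n.+1 y -> rho x y < n.+1%:R^-1) ->
  exists x, forall n, F n x.
Proof.
move=> F0 clF diamF; have [u Fu] := choice F0.
have decF m n : (m <= n)%N -> F n `<=` F m.
  elim: n => [|n IH]; first by rewrite leqn0 => /eqP ->.
  rewrite leq_eqVlt => /orP[/eqP ->//|mn] x Fx.
  by apply: IH => //; apply: clF; exact: subset_closure.
have [e e0|l ul] := rhoC (u := u).
  have [N Ne] : exists N, N.+1%:R^-1 < e.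
    have [N _ /(_ N)] := near_infty_natSinv_lt (PosNum e0).
    by move=> /(_ (leqnn N)) Ne; exists N.
  exists N.+1 => m n Nm Nn; apply: lt_trans Ne.
  by apply: diamF; [exact: (decF _ _ Nm)|exact: (decF _ _ Nn)].
exists l => n; apply: clF => B lB.
have [N _ NB] := ul _ lB.
exists (u (maxn N n.+1)); split; last by apply: NB; rewrite /= leq_maxl.
by apply: (decF _ (maxn N n.+1)) => //; rewrite leq_maxr.
Qed.

(** Baire's theorem for a complete metric given as a plain function: nest
    shrinking open sets, the n-th step entering [P n]. *)
Theorem complete_Baire (P : nat -> set X) :
  (forall n, open (P n)) -> (forall n, dense (P n)) -> dense (\bigcap_n P n).
Proof.
move=> oP dP O O0 oO.
have /choice[next nextP] (nA : nat * set X) : exists B : set X,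
    open nA.2 /\ nA.2 !=set0 ->
    [/\ open B /\ B !=set0, closure B `<=` nA.2 `&` P nA.1 &
        forall x y, B x -> B y -> rho x y < nA.1.+1%:R^-1].
  case: nA => n A /=; have [[oA A0]|] := pselect (open A /\ A !=set0).
    have [|||B [oB B0 clB dB]] := @shrink_open (A `&` P n) n.+1%:R^-1.
    - exact: openI.
    - exact: dP.
    - by rewrite invr_gt0.
    - by exists B => _.
  by move=> nA; exists set0.
pose F := fix F n := if n is m.+1 then next (m, F m) else O.
have FP n : open (F n) /\ F n !=set0.
  by elim: n => [//|n IH]; have [] := nextP (n, F n) IH.
have [|n x|n x y|x Fx] := @nested_point F.
- by move=> n; case: (FP n).
- by case: (nextP (n, F n) (FP n)) => _ + _ => /[apply] -[].
- by case: (nextP (n, F n) (FP n)) => _ _; exact.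
exists x; split; first exact: (Fx 0%N).
move=> n _; have [_ + _] := nextP (n, F n) (FP n).
by move=> /(_ x) []//; apply: subset_closure; exact: (Fx n.+1).
Qed.

End complete_metric.

Lemma open_rectangle (X Y : topologicalType) (A : set X) (B : set Y) :
  open A -> open B -> open (A `*` B).
Proof.
move=> oA oB; rewrite openE => -[x y] [/= Ax By].
by exists (A, B) => //=; split; exact: open_nbhs_nbhs.
Qed.

Lemma open_slice (X Y : topologicalType) (W : set (X * Y)) x :
  open W -> open [set y | W (x, y)].
Proof.
apply: (@open_comp _ _ (fun y : Y => (x, y))) => y _.
by apply: cvg_pair; [exact: cvg_cst|exact: cvg_id].
Qed.

Section open_families.
Context {X : topologicalType} {I : eqType}.
Implicit Types V : I -> set X.

Definition open_family V := forall i, open (V i) /\ V i !=set0.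

(** Density of [W] lets one shrink two members of the family so that their
    product enters [W]; later shrinkings preserve this, so finitely many pairs
    can be treated one after the other. *)
Lemma refine_open_family (W : set (X * X)) (l : seq (I * I)) V :
  open W -> dense W -> (forall p, p \in l -> p.1 != p.2) -> open_family V ->
  exists V', [/\ open_family V', forall i, V' i `<=` V i &
    forall p, p \in l -> V' p.1 `*` V' p.2 `<=` W].
Proof.
move=> oW dW; elim: l => [|[i k] l IH] nl oV.
  by exists V; split=> [|i|p]; [|exact: subset_refl|rewrite in_nil].
have [p pl|V1 [oV1 V1V V1W]] := IH _ oV.
  by apply: nl; rewrite inE pl orbT.
have ik : i != k by apply: (nl (i, k)); rewrite mem_head.
have [oi [xi Vxi]] := oV1 i; have [ok [xk Vxk]] := oV1 k.
have [|[x y] [[/= Vx Vy] Wxy]] := dW (V1 i `*` V1 k) _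
  (open_rectangle oi ok).
  by exists (xi, xk).
have [[A B] [/= xA yB] ABW] : nbhs (x, y) W by exact: open_nbhs_nbhs.
exists (fun m => if m == i then V1 i `&` A^°
                 else if m == k then V1 k `&` B^° else V1 m).
have sub m : (if m == i then V1 i `&` A^°
    else if m == k then V1 k `&` B^° else V1 m) `<=` V1 m.
  case: eqP => [->|_]; first exact: subIsetl.
  by case: eqP => [->|_//]; exact: subIsetl.
split.
- move=> m; case: eqP => _.
    by split; [exact/openI/open_interior|exists x].
  case: eqP => _ //.
  by split; [exact/openI/open_interior|exists y].
- by move=> m; apply: subset_trans (sub m) _; exact: V1V.
- move=> p; rewrite inE => /orP[/eqP ->/=|pl].
    rewrite eqxx (eq_sym k) (negPf ik) eqxx.
    move=> [a b] [/= [_ /interior_subset Aa] [_ /interior_subset Bb]].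
    exact: ABW.
  by move=> [a b] [/= /sub Va /sub Vb]; apply: (V1W p).
Qed.

End open_families.
(** * Ternary coding of the Cantor set *)

Section cantor_coding.
Context {R : realType}.
Implicit Types x y : R.

Definition cantor_digit x : bool := 1 < 3 * x.

(** The expanding map x |-> 3 x - 2 (digit of x), under which the Cantor set is
    invariant; reading the digit along its orbit gives the ternary expansion. *)
Definition cantor_shift x : R := if cantor_digit x then 3 * x - 2 else 3 * x.

(** The digits are listed from the last to the first, so that deleting the
    newest one, which leads from a node to its parent, is [behead]. *)
Fixpoint cantor_word n x : seq bool :=
  if n is m.+1 then cantor_digit (iter m cantor_shift x) :: cantor_word m x
  else [::].

Lemma size_cantor_word n x : size (cantor_word n x) = n.
Proof. by elim: n => //= n ->. Qed.

Lemma cantor_stage_itv n x : cantor_stage n x -> 0 <= x <= 1.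
Proof. by elim: n x => [//|n IH] x /= [/IH|/IH] => /andP[]; lra. Qed.

Lemma cantor_ternary0 : cantor_ternary (0 : R).
Proof.
move=> n _; elim: n => [|n IH] /=; first by rewrite lexx ler01.
by left; rewrite mulr0.
Qed.

Lemma cantor_ternary1 : cantor_ternary (1 : R).
Proof.
move=> n _; elim: n => [|n IH] /=; first by rewrite lexx ler01.
by right; have -> : 3 * 1 - 2 = 1 :> R by lra.
Qed.

Lemma cantor_ternary_itv x : cantor_ternary x -> 0 <= x <= 1.
Proof. by move=> /(_ 0%N I)/cantor_stage_itv. Qed.

Lemma cantor_ternary_gap x : cantor_ternary x -> 3 * x <= 1 \/ 2 <= 3 * x.
Proof. by move=> /(_ 1%N I) /= [|] /andP[] ? ?; [left|right]; lra. Qed.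

Lemma cantor_ternary_shift x :
  cantor_ternary x -> cantor_ternary (cantor_shift x).
Proof.
move=> Cx n _; rewrite /cantor_shift /cantor_digit.
by case: ltP => x1; have /= [|] // := Cx n.+1 I;
   move=> /cantor_stage_itv /andP[]; lra.
Qed.

Lemma cantor_ternary_iter_shift n x :
  cantor_ternary x -> cantor_ternary (iter n cantor_shift x).
Proof. by move=> Cx; elim: n => //= n /cantor_ternary_shift. Qed.

Lemma cantor_digit_eq x y : cantor_ternary x -> cantor_ternary y ->
  3 * `|x - y| < 1 -> cantor_digit x = cantor_digit y.
Proof.
move=> /cantor_ternary_gap Cx /cantor_ternary_gap Cy xy.
have {xy} : `|x - y| < 3^-1 by lra.
rewrite ltr_norml /cantor_digit => /andP[? ?].
by apply/idP/idP => ?; case: Cx => ?; case: Cy => ?; lra.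
Qed.

(** As long as the digits agree, the shift multiplies distances by exactly 3. So
    points of the Cantor set share a long word if and only if they are close,
    as the next two lemmas make precise. *)
Lemma cantor_shift_dist n x y : cantor_word n x = cantor_word n y ->
  `|iter n cantor_shift x - iter n cantor_shift y| = 3 ^+ n * `|x - y|.
Proof.
elim: n => [|n IH] /=; first by rewrite mul1r.
move=> [dxy /IH]; move: dxy; set a := iter _ _ _; set b := iter _ _ _ => dab ab.
rewrite exprS -mulrA -ab -[X in X * `|_|](ger0_norm (x := 3))// -normrM.
by rewrite /cantor_shift dab; case: ifP => _; congr (`|_|); lra.
Qed.

Lemma cantor_word_dist n x y : cantor_ternary x -> cantor_ternary y ->
  cantor_word n x = cantor_word n y -> 3 ^+ n * `|x - y| <= 1.
Proof.
move=> Cx Cy /cantor_shift_dist <-.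
have /cantor_ternary_itv := cantor_ternary_iter_shift n Cx.
have /cantor_ternary_itv := cantor_ternary_iter_shift n Cy.
by move=> /andP[? ?] /andP[? ?]; rewrite ler_norml; lra.
Qed.

Lemma cantor_word_eq n x y : cantor_ternary x -> cantor_ternary y ->
  3 ^+ n * `|x - y| < 1 -> cantor_word n x = cantor_word n y.
Proof.
move=> Cx Cy; elim: n => [//|n IH] xy /=.
have wxy : cantor_word n x = cantor_word n y.
  apply/IH/le_lt_trans/xy; rewrite exprS -mulrA.
  by apply: ler_peMl; [rewrite mulr_ge0|lra].
congr cons => //; apply: cantor_digit_eq.
- exact: cantor_ternary_iter_shift.
- exact: cantor_ternary_iter_shift.
- by rewrite cantor_shift_dist// mulrA -exprS.
Qed.

Lemma exists_expr3_gt (e : R) : 0 < e -> exists n, forall m, (n <= m)%N ->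
  1 < 3 ^+ m * e.
Proof.
move=> e0; have [n ne] : exists n, e^-1 < n%:R.
  by exists (Num.truncn e^-1).+1; exact: truncnS_gt.
exists n => m nm; rewrite -ltr_pdivrMr// div1r (lt_le_trans ne)//.
have : (n <= 3 ^ m)%N by apply: leq_trans nm _; apply: ltnW; exact: ltn_expl.
by rewrite -(ler_nat R) natrX.
Qed.

End cantor_coding.
(** * Cantor sets avoiding a meagre relation *)

Section mycielski.
Context {R : realType} (X : topologicalType) (rho : X -> X -> R).
Hypotheses (hrho : compatible_metric rho) (rhoC : complete_metric rho).
Variable W : nat -> set (X * X).
Hypotheses (oW : forall n, open (W n)) (dW : forall n, dense (W n)).

(** The node [(j, s)] is reached in the j-th tree by the word [s], newest digit
    first. A family lists sets for all nodes, but at stage [n] only the nodes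
    with words of size [n] matter; this keeps the stages in a single type. *)
Let node := (nat * seq bool)%type.
Implicit Types (V : node -> set X) (j k n : nat) (s t : seq bool).

Let level n : seq node :=
  [seq (j, s) | j <- iota 0 n.+1, s <- map val (enum {: n.+1.-tuple bool})].

Let mem_level n j s : (j <= n)%N -> size s = n.+1 -> (j, s) \in level n.
Proof.
move=> jn /eqP sn; apply/allpairsP; exists (j, s); split=> //.
  by rewrite mem_iota.
by apply/mapP; exists (Tuple sn); rewrite // mem_enum.
Qed.

(** One refinement of the scheme. The pairs of the first [n.+1] trees are put in
    [W n]; the j-th tree thus joins only at stage [j], which keeps the number
    of conditions finite. *)
Definition cantor_step n V V' :=
  [/\ open_family V',
      forall j s, closure (V' (j, s)) `<=` V (j, behead s),
      forall i x y, V' i x -> V' i y -> rho x y < n.+1%:R^-1 &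
      forall j k s t, (j <= n)%N -> (k <= n)%N ->
        size s = n.+1 -> size t = n.+1 -> (j, s) != (k, t) ->
        V' (j, s) `*` V' (k, t) `<=` W n].

Lemma exists_cantor_step n V : open_family V -> exists V', cantor_step n V V'.
Proof.
move=> oV; have /choice[V1 V1P] (i : node) : exists B : set X,
    [/\ open B, B !=set0, closure B `<=` V (i.1, behead i.2) &
    forall x y, B x -> B y -> rho x y < n.+1%:R^-1].
  by apply: shrink_open; rewrite ?invr_gt0//; case: (oV (i.1, behead i.2)).
pose l := [seq p <- [seq (a, b) | a <- level n, b <- level n] | p.1 != p.2].
have [|p|V' [oV' V'V1 V'W]] := refine_open_family (l := l) (V := V1) (@oW n)
  (@dW n).
- by move=> p; rewrite mem_filter => /andP[].
- by case: (V1P p).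
exists V'; split=> // [j s|i x y /V'V1 V1x /V'V1 V1y|j k s t jn kn sn tn jskt].
- have [_ _ V1V _] := V1P (j, s).
  exact: subset_trans (closure_subset (V'V1 _)) V1V.
- by case: (V1P i) => _ _ _; exact.
- apply: (V'W ((j, s), (k, t))); rewrite mem_filter jskt /=.
  by apply/allpairsP; exists ((j, s), (k, t)); rewrite /= !mem_level.
Qed.

Lemma exists_cantor_scheme (O : nat -> set X) :
  (forall j, open (O j) /\ O j !=set0) ->
  exists V : nat -> node -> set X,
    [/\ forall j s, V 0%N (j, s) = O j, forall n, open_family (V n) &
        forall n, cantor_step n (V n) (V n.+1)].
Proof.
move=> O0; have /choice[next nextP] (nV : nat * (node -> set X)) :
    exists V', open_family nV.2 -> cantor_step nV.1 nV.2 V'.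
  have [/(exists_cantor_step nV.1)[V' ?]|] := pselect (open_family nV.2).
    by exists V'.
  by exists nV.2.
pose V := fix V n := if n is m.+1 then next (m, V m) else fun i : node => O i.1.
have oV n : open_family (V n).
  by elim: n => [|n IH]; [move=> i; exact: (O0 i.1)|case: (nextP (n, V n) IH)].
by exists V; split=> // n; exact: (nextP (n, V n) (oV n)).
Qed.

Hypotheses (decW : forall m n, (m <= n)%N -> W n `<=` W m)
           (irrW : forall n x, ~ W n (x, x)).

(** Branches of the trees are read along ternary expansions, so a point [x] of
    the Cantor set selects a point [f j x] in each tree, and [f j] is an
    embedding: close points share a long word, hence the images lie in a common
    small set; conversely the sets of a level separate different words, because
    their products lie in some [W n], which misses the diagonal. *)
Theorem mycielski (O : nat -> set X) :
  (forall j, open (O j) /\ O j !=set0) ->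
  exists K : nat -> set X,
    (forall j, cantor_subset R (K j) /\ K j `<=` O j) /\
    forall x y, (\bigcup_j K j) x -> (\bigcup_j K j) y -> x <> y ->
      forall n, W n (x, y).
Proof.
move=> /exists_cantor_scheme[V [V0 oV VS]].
have /choice[f0 f0P] (jx : nat * R) :
    exists p, forall n, V n (jx.1, cantor_word n jx.2) p.
  case: jx => j x /=.
  apply: (nested_point rhoC (F := fun n => V n (j, cantor_word n x)))
    => [n|n|n a b].
  - by case: (oV n (j, cantor_word n x)).
  - by have [_ + _ _] := VS n; apply.
  - by have [_ _ + _] := VS n; apply.
pose f j x := f0 (j, x).
have fP j (x : R) n : V n (j, cantor_word n x) (f j x) by exact: (f0P (j, x)).
pose C : set R := cantor_ternary.
(* Different nodes of a level above n, j and k force the pair into W n. *)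
have fW n m j k (x y : R) : (n <= m)%N -> (j <= m)%N -> (k <= m)%N ->
    (j, cantor_word m.+1 x) != (k, cantor_word m.+1 y) -> W n (f j x, f k y).
  move=> nm jm km jxky; apply: (decW nm).
  have [_ _ _ /(_ j k _ _ jm km _ _ jxky)] := VS m.
  rewrite !size_cantor_word => /(_ erefl erefl).
  by apply; split; exact: fP.
(* Two sets of a level with a common point would put a diagonal pair in W n. *)
have f_word n j (x y : R) : (j <= n)%N ->
    V n.+1 (j, cantor_word n.+1 x) (f j y) ->
    cantor_word n.+1 x = cantor_word n.+1 y.
  move=> jn Vxy; apply/eqP/negPn/negP => xy.
  apply: (@irrW n (f j y)).
  have [_ _ _ /(_ j j (cantor_word n.+1 x) (cantor_word n.+1 y) jn jn)] := VS n.
  rewrite !size_cantor_word xpair_eqE eqxx => /(_ erefl erefl xy).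
  by apply; split => //; exact: fP.
have word_neq N (x y : R) : C x -> C y -> x != y ->
    exists2 m, (N <= m)%N & cantor_word m.+1 x != cantor_word m.+1 y.
  move=> Cx Cy xy; have [|m mP] := @exists_expr3_gt R `|x - y|.
    by rewrite normr_gt0 subr_eq0.
  exists (maxn N m); first exact: leq_maxl.
  apply/eqP => /(cantor_word_dist Cx Cy); apply/negP; rewrite -ltNge mP//.
  by rewrite leqW// leq_maxr.
exists (fun j => f j @` C); split; last first.
  move=> _ _ [j _ [x Cx <-]] [k _ [y Cy <-]] fxy n.
  have [jk|jk] := eqVneq j k; last first.
    apply: (@fW n (maxn n (maxn j k))); rewrite ?leq_max ?leqnn ?orbT//.
    by rewrite xpair_eqE negb_and jk.
  have xy : x != y by apply: contra_not_neq fxy => ->; rewrite jk.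
  have [m nm xym] := word_neq (maxn n (maxn j k)) _ _ Cx Cy xy.
  move: nm; rewrite !geq_max => /and3P[nm jm km].
  by apply: (@fW n m); rewrite // xpair_eqE negb_and xym orbT.
move=> j; split; last first.
  by move=> _ [x _ <-]; rewrite -(V0 j [::]); exact: fP.
have f_inj x y : C x -> C y -> f j x = f j y -> x = y.
  move=> Cx Cy fxy; apply/eqP/negPn/negP => xy.
  have [m jm /eqP] := word_neq j _ _ Cx Cy xy; apply.
  by apply: (@f_word m j) => //; rewrite -fxy; exact: fP.
have /choice[g gP] (p : X) : exists x, (f j @` C) p -> C x /\ f j x = p.
  have [[x Cx <-]|] := pselect ((f j @` C) p); first by exists x.
  by exists 0.
have gf x : C x -> g (f j x) = x.
  move=> Cx; have [|Cg fg] := gP (f j x); first by exists x.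
  exact: f_inj.
exists (f j), g; split.
- split; apply/subspace_continuousP.
    move=> x Cx B /(nbhs_metricP hrho)[e e0 eB].
    have [n ne] : exists n, n.+1%:R^-1 < e.
      by have [n _ /(_ n (leqnn n))] := near_infty_natSinv_lt (PosNum e0);
        exists n.
    exists (3 ^+ n.+1)^-1 => /=; first by rewrite invr_gt0 exprn_gt0.
    move=> y /= xy Cy; apply/eB/lt_trans/ne.
    have [_ _ /(_ (j, cantor_word n.+1 x)) + _] := VS n; apply; first exact: fP.
    rewrite (@cantor_word_eq _ n.+1 x y) //.
    by rewrite -ltr_pdivlMl ?exprn_gt0// mulr1.
  move=> _ [x Cx <-] B; rewrite /from_subspace /= gf// => -[e /= e0 eB].
  have [n ne] := exists_expr3_gt e0.
  have : nbhs (f j x) (V (maxn j n).+1 (j, cantor_word (maxn j n).+1 x)).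
    apply: open_nbhs_nbhs; split; last exact: fP.
    by case: (oV (maxn j n).+1 (j, cantor_word (maxn j n).+1 x)).
  apply: filterS => p /= + [y Cy yp]; rewrite /from_subspace -yp gf//.
  move=> /f_word.
  rewrite leq_maxl => /(_ isT)/(cantor_word_dist Cx Cy) xy.
  apply: eB => /=; have := ne (maxn j n).+1.
  rewrite leqW ?leq_maxr// => /(_ isT); move: xy => /le_lt_trans/[apply].
  by rewrite ltr_pM2l ?exprn_gt0.
- split=> [x Cx|p /gP[]//]; by exists x.
- by move=> x; rewrite inE; exact: gf.
- by move=> p; rewrite inE => /gP[].
Qed.

End mycielski.
(** * Averages of orbit distances *)

Section averages.
Context {R : realType}.
Implicit Types u v : nat -> R.

Lemma le_avg u v n : (forall i, u i <= v i) -> avg u n <= avg v n.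
Proof. by move=> uv; rewrite ler_wpM2l ?invr_ge0// ler_sum. Qed.

Lemma avgD u v n : avg (fun i => u i + v i) n = avg u n + avg v n.
Proof. by rewrite /avg big_split mulrDr. Qed.

Lemma avg_cst (c : R) n : (0 < n)%N -> avg (fun=> c) n = c.
Proof.
move=> n0; rewrite /avg sumr_const_nat subn1 /= -[c *+ n]mulr_natl mulrA.
rewrite mulVf ?mul1r//.
by rewrite pnatr_eq0 -lt0n.
Qed.

(** Dropping the first [k] terms costs at most a constant divided by [n]; half
    of the lower bound pays for it. *)
Lemma frequently_avg_shift u (c : R) k : (forall i, 0 <= u i) -> 0 < c ->
  frequently (fun n => c < avg u n) ->
  frequently (fun n => c / 2 < avg (fun i => u (i + k)%N) n).
Proof.
move=> u0 c0 cu N; pose S := \sum_(1 <= i < k.+1) u i.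
have S0 : 0 <= S by exact: sumr_ge0.
(* For m > M the omitted sum S is less than half of c * m. *)
pose M := (Num.truncn (c^-1 * (2 * S))).+1.
have [m] := cu (maxn M (N + k).+1).
rewrite geq_max => /andP[Mm Nkm] cm.
have m0 : 0 < m%:R :> R by rewrite ltr0n (leq_trans _ Nkm).
have km : (k < m)%N by apply: leq_trans Nkm; rewrite ltnS leq_addl.
exists (m - k)%N; first by rewrite -(leq_add2r k) subnK ltnW.
have mk0 : 0 < (m - k)%:R :> R by rewrite ltr0n subn_gt0.
have -> : avg (fun i => u (i + k)%N) (m - k) =
    (m - k)%:R^-1 * \sum_(k.+1 <= i < m.+1) u i.
  rewrite /avg -subSn ?(ltnW km)//; congr (_ * _).
  exact/esym/(big_addn 1 m.+1 k xpredT u).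
have SM : 2 * S < c * m%:R.
  rewrite -ltr_pdivrMl// (lt_le_trans (truncnS_gt _))//.
  by rewrite ler_nat.
have cm' : c * m%:R < S + \sum_(k.+1 <= i < m.+1) u i.
  by rewrite -big_cat_nat //= 1?ltnW// -ltr_pdivlMr// mulrC.
have mkm : (m - k)%:R <= m%:R :> R by rewrite ler_nat leq_subr.
rewrite ltr_pdivlMl// mulrC.
have : c / 2 * (m - k)%:R <= c / 2 * m%:R by rewrite ler_pM2l// divr_gt0.
lra.
Qed.

End averages.

Section orbit_averages.
Context {R : realType} (X : topologicalType) (d : X -> X -> R) (T : X -> X).
Hypothesis hd : compatible_metric d.

Definition orbit_avg x y : nat -> R := avg (orbit_dist d T x y).

Lemma orbit_avg_xx x n : orbit_avg x x n = 0.
Proof.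
by rewrite /orbit_avg /avg big1 ?mulr0// => i _; exact: metric_xx.
Qed.

Lemma orbit_avg_sym x y n : orbit_avg x y n = orbit_avg y x n.
Proof. by congr avg; apply/funext => i; exact: metric_sym. Qed.

Lemma orbit_avg_triangle y x z n :
  orbit_avg x z n <= orbit_avg x y n + orbit_avg y z n.
Proof. by rewrite -avgD; apply: le_avg => i; exact: metric_triangle. Qed.

Lemma mean_proximalP x y : mean_proximal d T x y <->
  forall e : R, 0 < e -> frequently (fun n => orbit_avg x y n < e).
Proof. by apply: mean_liminf_eq0 => i; exact: metric_ge0. Qed.

Lemma mean_proximal_xx x : mean_proximal d T x x.
Proof.
by apply/mean_proximalP => e e0 N; exists N; rewrite ?orbit_avg_xx.
Qed.

(** A long side of a triangle forces one of the other two sides to be long, for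
    infinitely many [n] by the pigeonhole principle. *)
Lemma frequently_orbit_avg_split y x z (c c1 c2 : R) : c1 + c2 <= c ->
  frequently (fun n => c < orbit_avg x z n) ->
  frequently (fun n => c1 < orbit_avg x y n) \/
  frequently (fun n => c2 < orbit_avg y z n).
Proof.
move=> c12 cxz; apply: frequently_or; apply: frequently_sub cxz => n cn.
have := orbit_avg_triangle y x z n.
by case: (ltP c1 (orbit_avg x y n)); [left|right; lra].
Qed.

Lemma frequently_orbit_avg_iter x y k (c : R) : 0 < c ->
  frequently (fun n => c < orbit_avg x y n) ->
  frequently (fun n => c / 2 < orbit_avg (iter k T x) (iter k T y) n).
Proof.
move=> c0 /(frequently_avg_shift k) H.
have -> : orbit_avg (iter k T x) (iter k T y) =
    avg (fun i => orbit_dist d T x y (i + k)%N).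
  by congr avg; apply/funext => i; rewrite /orbit_dist -!iterD.
by apply: H => // i; exact: metric_ge0.
Qed.

(** An average smaller than [r] has a term smaller than [r]. *)
Lemma mean_proximal_orbits_meet x y (r : R) : 0 < r ->
  mean_proximal d T x y -> exists i, d (iter i T x) (iter i T y) < r.
Proof.
move=> r0 /mean_proximalP /(_ r r0 1%N)[n n0 nr].
apply/not_existsP => far; move: nr; apply/negP; rewrite -leNgt.
rewrite -[leLHS](avg_cst _ n0); apply: le_avg => i.
by rewrite leNgt; apply/negP; exact: far.
Qed.

Hypothesis hT : continuous T.

Lemma continuous_orbit_avg n :
  continuous (fun p : X * X => orbit_avg p.1 p.2 n).
Proof.
have cT i : continuous (iter i T).
  elim: i => [|i IH] x; first exact: cvg_id.
  by apply: continuous_comp; [exact: IH|exact: hT].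
move=> p; apply: cvgM; first exact: cvg_cst.
apply: cvg_big => [|i _]; first exact: add_continuous.
apply: (@continuous_comp _ _ _
  (fun p : X * X => (iter i T p.1, iter i T p.2)) (fun q => d q.1 q.2)).
  apply: cvg_pair.
    by apply: continuous_comp; [exact: cvg_fst|exact: cT].
  by apply: continuous_comp; [exact: cvg_snd|exact: cT].
exact: continuous_metric.
Qed.

(** The open conditions whose intersection over [n] forces a mean Li-Yorke
    [delta]-chaotic pair. Using the same [n] for the time and for the
    closeness makes the sequence decreasing. *)
Definition chaotic_stage (delta : R) n : set (X * X) :=
  [set p | exists2 m, (n <= m)%N & orbit_avg p.1 p.2 m < n.+1%:R^-1] `&`
  [set p | exists2 m, (n <= m)%N & delta < orbit_avg p.1 p.2 m].

Lemma open_orbit_avg (n : nat) (B : set R) : open B ->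
  open [set p : X * X | exists2 m, (n <= m)%N & B (orbit_avg p.1 p.2 m)].
Proof.
move=> oB; rewrite (_ : [set _ | _] = \bigcup_(m in [set m | (n <= m)%N])
    ((fun p : X * X => orbit_avg p.1 p.2 m) @^-1` B)).
  apply: bigcup_open => m _; apply: open_comp => // p _.
  exact: continuous_orbit_avg.
by apply/seteqP; split=> p [m nm Bm]; exists m.
Qed.

Lemma open_chaotic_stage delta n : open (chaotic_stage delta n).
Proof.
apply: openI.
  exact: (@open_orbit_avg n [set r | r < n.+1%:R^-1] (@open_lt R _)).
exact: (@open_orbit_avg n [set r | delta < r] (@open_gt R _)).
Qed.

Lemma chaotic_stage_decreasing delta m n : (m <= n)%N ->
  chaotic_stage delta n `<=` chaotic_stage delta m.
Proof.
move=> mn p [[k nk close] [l nl far]]; split.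
  exists k; first exact: leq_trans nk.
  by apply: lt_le_trans close _; rewrite lef_pV2 ?posrE// ler_nat.
by exists l => //; exact: leq_trans nl.
Qed.

Lemma chaotic_stage_irreflexive delta n x : 0 < delta ->
  ~ chaotic_stage delta n (x, x).
Proof.
by move=> d0 [_ [m _ /=]]; rewrite orbit_avg_xx => /(lt_trans d0); rewrite ltxx.
Qed.

Lemma chaotic_stage_chaotic delta x y :
  (forall n, chaotic_stage delta n (x, y)) ->
  mean_li_yorke_chaotic d T delta x y.
Proof.
move=> Wxy; split; last by apply: mean_limsup_ge => n; have [] := Wxy n.
apply/mean_proximalP => e e0 N.
have [M _ /(_ (maxn M N) (leq_maxl _ _)) /= Me] :=
  near_infty_natSinv_lt (PosNum e0).
have [[m + me] _] := Wxy (maxn M N); rewrite geq_max => /andP[_ Nm].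
by exists m => //; exact: lt_trans Me.
Qed.

End orbit_averages.
(** * Endomorphisms and left-invariant metrics *)

Section endomorphism.
Context {R : realType} (G : topologicalGroupType) (d : G -> G -> R).
Variable T : {multiplicative G -> G}.
Hypotheses (hd : compatible_metric d) (hdl : left_invariant d).

Local Notation A := (orbit_avg d T).

Lemma iter_endo_mulg i x y :
  iter i T (x * y)%g = (iter i T x * iter i T y)%g.
Proof. by elim: i => //= i ->; rewrite gmulfM. Qed.

Lemma iter_endo1 i : iter i T 1%g = 1%g.
Proof.
elim: i => //= i ->; apply: (mulgI (T 1%g)).
by rewrite -gmulfM !mulg1.
Qed.

Lemma orbit_dist_mulg z x y :
  orbit_dist d T (z * x)%g (z * y)%g = orbit_dist d T x y.
Proof. by apply/funext => i; rewrite /orbit_dist !iter_endo_mulg hdl. Qed.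

Lemma orbit_dist1 x : orbit_dist d T 1%g x = (fun i => d (iter i T x) 1%g).
Proof.
by apply/funext => i; rewrite /orbit_dist iter_endo1; exact: metric_sym.
Qed.

Lemma metric_mul1 x y : d x (x * y)%g = d 1%g y.
Proof. by rewrite -[X in d X _](mulg1 x) hdl. Qed.

Lemma orbit_avg_mul1 x y n : A x (x * y)%g n = A 1%g y n.
Proof.
by rewrite /orbit_avg -[X in orbit_dist d T X _](mulg1 x) orbit_dist_mulg.
Qed.

Lemma mean_semi_irregularE x : mean_semi_irregular d T x <->
  mean_proximal d T 1%g x /\ (0 < mean_limsup (orbit_dist d T 1%g x))%E.
Proof. by rewrite /mean_proximal orbit_dist1. Qed.

(** Move a point with large averages to a nearby [z] that is mean proximal to
    [1]. If no point near [1] had large averages, [z] would inherit them; but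
    the orbit of [z] enters every neighbourhood of [1], and the averages of
    its points have the same upper limit. *)
Lemma spread_near1 (c : R) x0 : 0 < c -> dense (mean_proximal_cell d T 1%g) ->
  frequently (fun n => c < A 1%g x0 n) ->
  forall r : R, 0 < r -> exists2 y, d 1%g y < r &
    frequently (fun n => c / 4 < A 1%g y n).
Proof.
move=> c0 dP cx0 r r0; apply/not_exists2P => small.
have nospread y : d 1%g y < r -> ~ frequently (fun n => c / 4 < A 1%g y n).
  by move=> yr; case: (small y).
have [||z [/= x0z z1]] := dP [set z | d x0 z < r].
- by exists x0 => /=; rewrite metric_xx.
- exact: open_metric_ball.
pose y := (x0^-1 * z)%g; have zE : z = (x0 * y)%g by rewrite mulVKg.
have cz : frequently (fun n => c / 2 < A 1%g z n).
  have [||//|] := @frequently_orbit_avg_split R G d T hd z 1%g x0 c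
    (c / 2) (c / 4).
  - by lra.
  - exact: cx0.
  - move=> czx0; case: (nospread y); first by rewrite -(metric_mul1 x0) -zE.
    apply: frequently_sub czx0 => n.
    by rewrite (orbit_avg_sym _ hd) zE orbit_avg_mul1.
have [i zi] := mean_proximal_orbits_meet hd r0 z1.
have := frequently_orbit_avg_iter hd i (divr_gt0 c0 (ltr0Sn _ 1)) cz.
rewrite iter_endo1 => ci; apply: (nospread (iter i T z)).
  by rewrite iter_endo1 in zi.
by apply: frequently_sub ci => n; lra.
Qed.

(** If [x] itself does not have large averages, multiply it on the right by a
    point near [1] that does: at most half of the averages is lost. *)
Lemma dense_spread (c : R) :
  (forall r : R, 0 < r ->
    exists2 y, d 1%g y < r & frequently (fun n => c < A 1%g y n)) ->
  dense [set x | frequently (fun n => c / 2 < A 1%g x n)].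
Proof.
move=> near1 O [x Ox] oO.
have /(nbhs_metricP hd)[r r0 rO] : nbhs x O by exact: open_nbhs_nbhs.
have [y yr cy] := near1 r r0.
have [||cx|cxy] := @frequently_orbit_avg_split R G d T hd 1%g x (x * y)%g c
    (c / 2) (c / 2).
- by lra.
- by apply: frequently_sub cy => n; rewrite orbit_avg_mul1.
- exists x; split=> //=.
  by apply: frequently_sub cx => n; rewrite orbit_avg_sym.
- by exists (x * y)%g; split=> //; apply: rO; rewrite metric_mul1.
Qed.

(** Both halves of the stage are open and dense, the first because it contains
    the proximal cell of [1]. *)
Lemma dense_chaotic_stage1 : continuous T ->
  dense (mean_proximal_cell d T 1%g) ->
  (exists x, (0 < mean_limsup (orbit_dist d T 1%g x))%E) ->
  exists2 delta : R, 0 < delta &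
    forall n, dense [set x | chaotic_stage d T delta n (1%g, x)].
Proof.
move=> hT dP [x0 /mean_limsup_gt0[c c0 cx0]].
(* A factor 1 / 4 is lost near 1, and another 1 / 2 by translation. *)
exists (c / 4 / 2); first by rewrite !divr_gt0.
have dS := dense_spread (spread_near1 c0 dP cx0).
move=> n; rewrite (_ : [set _ | _] =
  [set x | exists2 m, (n <= m)%N & A 1%g x m < n.+1%:R^-1] `&`
  [set x | exists2 m, (n <= m)%N & c / 4 / 2 < A 1%g x m])//.
apply: denseI.
- apply: (@open_slice _ _
    [set p : G * G | exists2 m, (n <= m)%N & A p.1 p.2 m < n.+1%:R^-1]).
  exact: (@open_orbit_avg R G d T hd hT n [set r | r < n.+1%:R^-1]
    (@open_lt R _)).
- move=> O O0 oO; have [x [Ox /= /(mean_proximalP _ hd) x1]] := dP O O0 oO.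
  by exists x; split=> //=; apply: x1; rewrite invr_gt0.
- move=> O O0 oO; have [x [Ox /= cx]] := dS O O0 oO.
  by exists x; split=> //=; exact: cx.
Qed.

(** Near [(x, y)], keep [x] and move [y] to [x * w] with [w] near [x^-1 * y]. *)
Lemma dense_chaotic_stage (delta : R) n :
  dense [set x | chaotic_stage d T delta n (1%g, x)] ->
  dense (chaotic_stage d T delta n).
Proof.
move=> dS O [[x y] Oxy] oO.
have [[B C] /= [Bx Cy] BCO] : nbhs (x, y) O by exact: open_nbhs_nbhs.
have /(nbhs_metricP hd)[r r0 rC] := Cy.
have [||w [/= wr Sw]] := dS [set w | d (x^-1 * y)%g w < r].
- by exists (x^-1 * y)%g => /=; rewrite metric_xx.
- exact: open_metric_ball.
exists (x, (x * w)%g); split.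
  apply: BCO; split; first exact: nbhs_singleton.
  by apply: rC; rewrite -(mulVKg x y) hdl.
case: Sw => -[m nm close] [k nk far]; split; [exists m|exists k] => //=;
  by rewrite orbit_avg_mul1.
Qed.

End endomorphism.

Lemma cantor_subset_two (R : realType) (X : topologicalType) (K : set X) :
  cantor_subset R K -> exists a b, [/\ K a, K b & a <> b].
Proof.
move=> [f [g [_ [fK _] gf _]]]; exists (f 0), (f 1); split.
- exact/fK/cantor_ternary0.
- exact/fK/cantor_ternary1.
- move=> /(congr1 g); rewrite !gf ?inE; last first.
  + exact: cantor_ternary0.
  + exact: cantor_ternary1.
  by apply/eqP; rewrite eq_sym oner_eq0.
Qed.
(** * The equivalence *)

Theorem theorem4p13 (R : realType) (G : topologicalGroupType)
    (d : G -> G -> R) (T : {multiplicative G -> G})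
    (hG : completely_metrizable R G)
    (hd : compatible_metric d) (hdl : left_invariant d)
    (hT : continuous T) :
  [<-> dense [set x : G | mean_semi_irregular d T x] ;
       residual [set x : G | mean_semi_irregular d T x] ;
       exists2 delta : R, 0 < delta &
         forall O : nat -> set G, (forall j, open (O j) /\ O j !=set0) ->
         exists K : nat -> set G,
           (forall j, cantor_subset R (K j) /\ K j `<=` O j) /\
           mean_li_yorke_scrambled d T delta (\bigcup_j K j) ;
       dense (mean_proximal_relation d T) /\ mean_sensitive d T ;
       dense (mean_proximal_cell d T 1%g) /\
         exists x : G, (0 < mean_limsup (fun i => d (iter i T x) 1%g))%E ].
Proof.
have [rho [hrho rhoC]] := hG.
have semi_cell : dense [set x : G | mean_semi_irregular d T x] ->
    dense (mean_proximal_cell d T 1%g) /\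
    exists x : G, (0 < mean_limsup (orbit_dist d T 1%g x))%E.
  move=> dS; split.
    move=> O O0 oO.
    have [x [Ox /(mean_semi_irregularE T hd)[x1 _]]] := dS O O0 oO.
    by exists x.
  have [|x [_ /(mean_semi_irregularE T hd)[_ x1]]] := dS setT _ openT.
    by exists 1%g.
  by exists x.
have cell_stage : dense (mean_proximal_cell d T 1%g) /\
    (exists x : G, (0 < mean_limsup (orbit_dist d T 1%g x))%E) ->
    exists2 delta : R, 0 < delta &
      forall n, dense [set x | chaotic_stage d T delta n (1%g, x)].
  by case; exact: dense_chaotic_stage1.
have stage_residual : (exists2 delta : R, 0 < delta &
      forall n, dense [set x | chaotic_stage d T delta n (1%g, x)]) ->
    residual [set x : G | mean_semi_irregular d T x].
  move=> [delta d0 dS].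
  have oS n : open [set x | chaotic_stage d T delta n (1%g, x)].
    exact/open_slice/open_chaotic_stage.
  exists (\bigcap_n [set x | chaotic_stage d T delta n (1%g, x)]); split.
  - by exists (fun n => [set x | chaotic_stage d T delta n (1%g, x)]).
  - exact: complete_Baire hrho rhoC _ oS dS.
  - move=> x Sx; apply/(mean_semi_irregularE T hd).
    have [x1 dx] : mean_li_yorke_chaotic d T delta 1%g x.
      by apply: (chaotic_stage_chaotic hd) => n; exact: Sx.
    by split=> //; apply: lt_le_trans dx; rewrite lte_fin.
have residual_dense : residual [set x : G | mean_semi_irregular d T x] ->
    dense [set x : G | mean_semi_irregular d T x].
  by move=> [D [_ dD DS]] O O0 oO; have [x [Ox /DS]] := dD O O0 oO; exists x.
tfae.
- by move=> /semi_cell/cell_stage/stage_residual.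
- move=> /residual_dense/semi_cell/cell_stage[delta d0 dS].
  exists delta => // O oO.
  have [||m n|n x|K [KO KW]] := @mycielski R G rho hrho rhoC
    (chaotic_stage d T delta) _ _ _ _ O oO.
  - by move=> n; exact: open_chaotic_stage.
  - by move=> n; exact: dense_chaotic_stage.
  - exact: chaotic_stage_decreasing.
  - exact: chaotic_stage_irreflexive.
  exists K; split=> // x y Kx Ky xy.
  by apply: (chaotic_stage_chaotic hd); exact: KW.
- move=> [delta d0 scr]; split.
    move=> O [[x y] Oxy] oO.
    have [[B C] /= [Bx Cy] BCO] : nbhs (x, y) O by exact: open_nbhs_nbhs.
    have [|K [KO KS]] := scr (fun j => if j is 0%N then B^° else C^°).
      case=> [|j]; split; do ?exact: open_interior.
        by exists x.
      by exists y.
    have [a [_ [K0a _ _]]] := cantor_subset_two (KO 0%N).1.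
    have [b [_ [K1b _ _]]] := cantor_subset_two (KO 1%N).1.
    exists (a, b); split.
      apply: BCO; split; apply: interior_subset; first exact: (KO 0%N).2.
      exact: (KO 1%N).2.
    have [->|ab] := pselect (a = b); first exact: mean_proximal_xx.
    by have [] := KS a b (ex_intro2 _ _ 0%N I K0a) (ex_intro2 _ _ 1%N I K1b) ab.
  exists (delta / 4); first by rewrite divr_gt0.
  move=> x eps e0.
  have [|K [KO KS]] := scr (fun=> [set y | d x y < eps]).
    by split; [exact: open_metric_ball|exists x; rewrite /= metric_xx].
  have [a [b [Ka Kb ab]]] := cantor_subset_two (KO 0%N).1.
  have [_ dab] := KS a b (ex_intro2 _ _ 0%N I Ka) (ex_intro2 _ _ 0%N I Kb) ab.
  have /mean_limsup_gt fab :
      ((delta / 2)%:E < mean_limsup (orbit_dist d T a b))%E.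
    by apply: lt_le_trans dab; rewrite lte_fin; lra.
  have [||fa|fb] := @frequently_orbit_avg_split R G d T hd x a b (delta / 2)
    (delta / 4) (delta / 4).
  - by lra.
  - exact: fab.
  - exists a; split; first exact: (KO 0%N).2.
    apply: mean_limsup_ge; apply: frequently_sub fa => n.
    by rewrite (orbit_avg_sym _ hd).
  - by exists b; split; [exact: (KO 0%N).2|exact: mean_limsup_ge].
- move=> [dP [delta d0 sens]]; split; last first.
    have [y [_ dy]] := sens 1%g 1 ltr01.
    by exists y; rewrite -orbit_dist1//; apply: lt_le_trans dy; rewrite lte_fin.
  move=> O [w Ow] oO.
  have /(nbhs_metricP hd)[r r0 rO] : nbhs w O by exact: open_nbhs_nbhs.
  have cw : continuous (fun x : G => (x * w)%g).
    move=> x; apply: (@continuous_comp _ _ _ (fun x : G => (x, w))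
      (fun p : G * G => (p.1 * p.2)%g)); last exact: mulg_continuous.
    by apply: cvg_pair; [exact: cvg_id|exact: cvg_cst].
  have [||[x y] [[/= xw wy] xy]] := dP
    ([set x | d w (x * w)%g < r / 2] `*` [set y | d w y < r / 2]).
  - by exists (1%g, w); split; rewrite /= ?mul1g metric_xx ?divr_gt0.
  - apply: open_rectangle; last exact: open_metric_ball.
    apply: (@open_comp _ _ (fun x : G => (x * w)%g) [set z | d w z < r / 2]).
      by move=> x _; exact: cw.
    exact: open_metric_ball.
  exists (x^-1 * y)%g; split.
    apply: rO; rewrite -(hdl _ _ x) mulVKg.
    have := metric_triangle hd w (x * w)%g y.
    by rewrite (metric_sym hd (x * w)%g w); lra.
  by rewrite /mean_proximal_cell /= /mean_proximal -(orbit_dist_mulg T hdl x)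
    mulg1 mulVKg.
- move=> [dP [x lx]]; apply/residual_dense/stage_residual/cell_stage.
  by split=> //; exists x; rewrite orbit_dist1.
Qed.
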